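(* Let $q=2^m$ with $m$ odd and let $n\ge 1$ be an integer. There is a Kakeya set $K\subset \mathbb{F}_q^n$ such that $$ |K| < \frac{8q}{5q+2\sqrt{q}-3}\left(\frac{5q+2\sqrt{q}+5}{8}\right)^n . $$
   Context: $\mathbb{F}_q$ denotes the finite field with $q$ elements (so $m\ge 1$). A set $K\subset\mathbb{F}_q^n$ is a Kakeya set if for every $\mathbf{x}\in\mathbb{F}_q^n$ there exists $\mathbf{y}\in\mathbb{F}_q^n$ such that $\{\mathbf{y}+t\mathbf{x} : t\in\mathbb{F}_q\}\subset K$. *)

(* Defs.v *)
From mathcomp Require Import all_boot all_order all_algebra all_field.

Set Implicit Arguments.
Unset Strict Implicit.
Unset Printing Implicit Defensive.

Import GRing.Theory.
Local Open Scope ring_scope.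

Definition line (F : finFieldType) (n : nat) (y x : 'rV[F]_n) : {set 'rV[F]_n} :=
  [set y + t *: x | t : F].

(* The direction x = 0 is allowed; it only asks that K be nonempty. *)
Definition kakeya (F : finFieldType) (n : nat) (K : {set 'rV[F]_n}) : Prop :=
  forall x : 'rV[F]_n, exists y : 'rV[F]_n, line y x \subset K.

(* Main.v *)
Require Import Defs.
From mathcomp Require Import all_boot all_order all_algebra all_field.
From mathcomp Require Import ring lra.

Import Order.TTheory GRing.Theory Num.Theory.
Local Open Scope ring_scope.

(** Write q = #|F|, and for u in F put
    I(u) = {x^2 + u x : x in F}. In characteristic 2 the map x |-> x^2 + u x
    takes the same value at x and at x + u, so |I(u)| <= q/2 unless u = 0.

    Fix shifts c_0, c_1, ... in F. A nonzero direction can be scaled to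
    (b_0, ..., b_{k-1}, 1, 0, ..., 0). The line in this direction through the
    point with coordinates b_i^2 + c_i b_i for i < k, and 0 elsewhere, consists
    of the points (b_i^2 + (c_i + t) b_i, ..., t, 0, ..., 0), so it lies in
    the union over t of the boxes I(c_0 + t) x ... x I(c_{k-1} + t) x {t} x
    {0} x ... x {0}. The union of all these boxes is therefore a Kakeya set,
    of cardinality at most sum_{k < n} S_k, where
    S_k = sum_t prod_{i < k} |I(c_i + t)|.

    With all shifts equal, the slice where c_i + t = 0 would have size q^k.
    Varying the shifts spreads this loss out. When c_k is chosen so that
    c_k + t vanishes at the t for which prod_{i < k} |I(c_i + t)| is smallest,
    that product is at most S_k / q, and
    S_{k+1} <= (q/2) (S_k + S_k / q) = ((q + 1)/2) S_k.
    Hence S_k <= q ((q + 1)/2)^k.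

    Finally (q + 1)/2 <= s := (5 q + 2 sqrt q + 5)/8, and summing the geometric
    series gives |K| <= q (s^n - 1)/(s - 1) < q s^n/(s - 1), which is the
    claimed bound. *)

(** The set I(u) of values of the polynomial x^2 + u x. *)
Definition quad_image (F : finFieldType) (u : F) : {set F} :=
  [set x ^+ 2 + u * x | x : F].

Lemma card_quad_image (F : finFieldType) (u : F) :
  2%N \in [pchar F] -> u != 0 -> (2 * #|quad_image F u| <= #|F|)%N.
Proof.
move=> F2 u0.
rewrite -[X in (_ <= X)%N]sum1_card.
rewrite (partition_big_imset (fun x : F => x ^+ 2 + u * x)) /=.
rewrite mulnC -sum_nat_const; apply: leq_sum => _ /imsetP[x _ ->].
rewrite sum1_card.
have card2x : #|pred2 x (x + u)| = 2%N.
  by rewrite card2 -[X in X == _]addr0 (inj_eq (addrI x)) eq_sym u0.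
rewrite -[X in (X <= _)%N]card2x.
apply/subset_leq_card/subsetP => z; rewrite inE => /orP[] /eqP ->.
  by rewrite unfold_in /=; apply/eqP.
rewrite unfold_in /=; apply/eqP.
(* the two values differ by u^2 + u^2 + 2 u x, which is 0 *)
apply/eqP; rewrite -subr_eq0; apply/eqP.
transitivity ((u + u) * (u + x)); first by ring.
by rewrite addrr_pchar2 // mul0r.
Qed.

(** The number of points of I(c_0 + t) x ... x I(c_{d-1} + t). *)
Definition slice_size (F : finFieldType) (c : nat -> F) (d : nat) (t : F) : nat :=
  (\prod_(i < d) #|quad_image F (c i + t)%R|)%N.

(** If the factor of index [d] is full exactly at a height where the product of
    the previous factors is smallest, then that factor multiplies the total size
    by at most (q + 1) / 2. *)
Lemma sum_slice_size_step (F : finFieldType) (c : nat -> F) (d : nat) :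
  2%N \in [pchar F] ->
  (forall t, slice_size F c d (- c d) <= slice_size F c d t)%N ->
  (2 * \sum_t slice_size F c d.+1 t <= #|F|.+1 * \sum_t slice_size F c d t)%N.
Proof.
move=> F2 cmin; set w := slice_size F c d.
have sliceS t : slice_size F c d.+1 t = (w t * #|quad_image F (c d + t)%R|)%N.
  by rewrite /slice_size big_ord_recr.
have wmin : (#|F| * w (- c d) <= \sum_t w t)%N.
  by rewrite -sum_nat_const; apply: leq_sum.
apply: (@leq_trans (#|F| * (\sum_t w t + w (- c d)))); last first.
  by rewrite mulnDr mulSn addnC leq_add2r.
have -> : (\sum_t w t + w (- c d) = \sum_t (w t + (t == - c d) * w t))%N.
  rewrite big_split /=; congr (_ + _)%N.
  rewrite (bigD1 (- c d)) //= eqxx mul1n big1 ?addn0 // => t /negPf ->.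
  by rewrite mul0n.
rewrite !big_distrr /=; apply: leq_sum => t _; rewrite sliceS.
case: eqVneq => [->|tc].
  rewrite mul1n addnn -mul2n !mulnA [(#|F| * 2)%N]mulnC -!mulnA leq_mul2l /=.
  by rewrite mulnC leq_mul2r max_card orbT.
rewrite mul0n addn0 mulnCA mulnC leq_mul2r card_quad_image ?orbT //.
by rewrite addrC -[c d]opprK subr_eq0.
Qed.

Lemma slice_size_eq (F : finFieldType) (c c' : nat -> F) (d : nat) (t : F) :
  (forall i, (i < d)%N -> c i = c' i) -> slice_size F c d t = slice_size F c' d t.
Proof. by move=> cc'; apply: eq_bigr => i _; rewrite cc'. Qed.

(** Greedy choice of the shifts: each new one satisfies the minimality condition
    of [sum_slice_size_step]. *)
Lemma exists_shifts (F : finFieldType) (n : nat) :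
  2%N \in [pchar F] ->
  exists c : nat -> F, forall d, (d <= n)%N ->
    (2 ^ d * \sum_t slice_size F c d t <= #|F| * #|F|.+1 ^ d)%N.
Proof.
move=> F2; elim: n => [|n [c cP]].
  exists (fun=> 0) => d; rewrite leqn0 => /eqP ->.
  rewrite !expn0 mul1n muln1 (eq_bigr (fun=> 1%N)) ?sum1_card //.
  by move=> t _; rewrite /slice_size big_ord0.
have [t0 _ t0min] := arg_minnP (slice_size F c n) (erefl : xpredT (0 : F)).
pose c' i := if i == n then - t0 else c i.
have c'E d t : (d <= n)%N -> slice_size F c' d t = slice_size F c d t.
  move=> dn; apply: slice_size_eq => i id.
  by rewrite /c' ltn_eqF // (leq_trans id).
have c'P d : (d <= n)%N ->
    (2 ^ d * \sum_t slice_size F c' d t <= #|F| * #|F|.+1 ^ d)%N.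
  by move=> dn; under eq_bigr do rewrite c'E //; apply: cP.
exists c' => d; rewrite leq_eqVlt => /orP[/eqP->|]; last exact: c'P.
have step : (2 * \sum_t slice_size F c' n.+1 t
              <= #|F|.+1 * \sum_t slice_size F c' n t)%N.
  by apply: sum_slice_size_step => // t; rewrite !c'E // /c' eqxx opprK t0min.
rewrite expnSr -mulnA (leq_trans (leq_mul (leqnn _) step)) //.
by rewrite mulnCA expnS [X in (_ <= X)%N]mulnCA leq_mul2l c'P ?orbT.
Qed.

(** Rectangular boxes of row vectors. *)
Definition box (F : finFieldType) (n : nat) (D : 'I_n -> {set F}) :
  {set 'rV[F]_n} := [set v : 'rV[F]_n | [forall i, v 0 i \in D i]].

Lemma card_box (F : finFieldType) (n : nat) (D : 'I_n -> {set F}) :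
  #|box F n D| = (\prod_i #|D i|)%N.
Proof.
rewrite -cardsXn.
have finj : injective (fun v : 'rV[F]_n => [ffun i : 'I_n => v 0 i]).
  by move=> v w /ffunP vw; apply/rowP => i; have := vw i; rewrite !ffunE.
rewrite -(card_imset _ finj); apply: eq_card => g; apply/imsetP/setXnP.
  by move=> [v]; rewrite inE => /forallP vD -> i; rewrite ffunE.
move=> gD; exists (\row_i g i); last by apply/ffunP => i; rewrite ffunE mxE.
by rewrite inE; apply/forallP => i; rewrite mxE.
Qed.

Lemma leq_card_bigcup (I T : finType) (A : I -> {set T}) :
  (#|\bigcup_i A i| <= \sum_i #|A i|)%N.
Proof.
elim/big_rec2: _ => [|i m B _ Bm]; first by rewrite cards0.
by rewrite (leq_trans (leq_card_setU _ _)) // leq_add2l.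
Qed.

(** The sides of the box I(c_0 + t) x ... x I(c_{k-1} + t) x {t} x {0} x ... x {0},
    which serves the directions whose last nonzero coordinate has index [k]. *)
Definition kakeya_side (F : finFieldType) (n : nat) (c : nat -> F) (k : 'I_n)
    (t : F) (i : 'I_n) : {set F} :=
  if (i < k)%N then quad_image F (c i + t) else if i == k then [set t] else [set 0].

(** The candidate Kakeya set attached to the shifts [c]. *)
Definition box_union (F : finFieldType) (n : nat) (c : nat -> F) :
  {set 'rV[F]_n} := \bigcup_(k : 'I_n) \bigcup_(t : F) box F n (kakeya_side F n c k t).

Lemma mem_box_union (F : finFieldType) (n : nat) (c : nat -> F) (k : 'I_n)
    (t : F) (v : 'rV[F]_n) :
  (forall i, v 0 i \in kakeya_side F n c k t i) -> v \in box_union F n c.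
Proof.
move=> vD; apply/bigcupP; exists k => //; apply/bigcupP; exists t => //.
by rewrite inE; apply/forallP.
Qed.

Lemma kakeya_box_union (F : finFieldType) (n : nat) (c : nat -> F) :
  (0 < n)%N -> kakeya (box_union F n c).
Proof.
move=> n0 x; have [->|] := eqVneq x 0.
  exists 0; apply/subsetP => _ /imsetP[t _ ->].
  rewrite scaler0 addr0; apply: (mem_box_union F n c (Ordinal n0) 0) => i.
  by rewrite mxE /kakeya_side ltn0; case: eqP; rewrite inE.
move=> x0; have /existsP[j xj] : [exists j, x 0 j != 0].
  apply: contraR x0; rewrite negb_exists => /forallP x0.
  by apply/eqP/rowP => j; rewrite mxE; apply/eqP; rewrite -[_ == _]negbK x0.
(* k is the index of the last nonzero coordinate of x, and b = x / x_k *)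
pose P := fun i : 'I_n => x 0 i != 0.
have [k xk kmax] := @arg_maxnP _ j P (@nat_of_ord n) xj.
pose b i := x 0 i / x 0 k.
exists (\row_i if (i < k)%N then b i ^+ 2 + c i * b i else 0).
apply/subsetP => _ /imsetP[t _ ->].
(* the point with parameter t has coordinate t x_k at index k *)
apply: (mem_box_union F n c k (t * x 0 k)) => i; rewrite !mxE /kakeya_side.
have xE : t * x 0 i = t * x 0 k * b i by rewrite /b; field.
case: ltnP => [ik|ki].
  by apply/imsetP; exists (b i) => //; rewrite xE mulrDl addrA.
rewrite add0r; case: eqVneq => [->|ik]; rewrite inE //.
rewrite mulf_eq0; apply/orP; right; apply: contraNT ik => xi.
by rewrite -val_eqE eqn_leq ki andbT; apply: kmax.
Qed.

Lemma card_box_union (F : finFieldType) (n : nat) (c : nat -> F) :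
  (#|box_union F n c| <= \sum_(k < n) \sum_t slice_size F c k t)%N.
Proof.
apply: (leq_trans (leq_card_bigcup _ _ _)); apply: leq_sum => k _.
apply: (leq_trans (leq_card_bigcup _ _ _)); apply: leq_sum => t _.
rewrite card_box /slice_size.
rewrite (big_ord_widen n (fun i => #|quad_image F (c i + t)|)) ?(ltnW (ltn_ord k)) //.
rewrite [X in (_ <= X)%N]big_mkcond /=; apply: leq_prod => i _.
by rewrite /kakeya_side; case: ifP => // _; case: ifP; rewrite cards1.
Qed.

(** In even characteristic there are Kakeya sets with at most
    [\sum_(k < n) q ((q + 1) / 2) ^ k] points. *)
Lemma exists_small_kakeya (R : numFieldType) (F : finFieldType) (n : nat) :
  2%N \in [pchar F] -> (0 < n)%N ->
  exists K : {set 'rV[F]_n}, kakeya K /\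
    (#|K|%:R : R) <= \sum_(k < n) #|F|%:R * ((#|F|%:R + 1) / 2) ^+ k.
Proof.
move=> F2 n0; have [c cP] := exists_shifts F n F2.
exists (box_union F n c); split; first exact: kakeya_box_union.
apply: (@le_trans _ _ (\sum_(k < n) \sum_t slice_size F c k t)%:R).
  by rewrite ler_nat card_box_union.
rewrite natr_sum; apply: ler_sum => k _.
rewrite expr_div_n mulrA ler_pdivlMr ?exprn_gt0 ?ltr0n //.
by rewrite -natrX mulrC -natrM natr1 -natrX -natrM ler_nat cP // ltnW.
Qed.

Theorem theorem6 (R : rcfType) (F : finFieldType) (m n : nat)
    (hm : odd m) (hF : #|F| = (2 ^ m)%N) (hn : (1 <= n)%N) :
  let q : R := #|F|%:R in
  exists K : {set 'rV[F]_n}, kakeya K /\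
    (#|K|%:R : R) <
      8 * q / (5 * q + 2 * Num.sqrt q - 3) *
        ((5 * q + 2 * Num.sqrt q + 5) / 8) ^+ n.
Proof.
move=> q.
have F2 : 2%N \in [pchar F] := card_finPcharP hF isT.
have [K [Kkak Kle]] := exists_small_kakeya R F n F2 hn.
exists K; split => //; apply: (le_lt_trans Kle); rewrite -/q.
have q1 : 1 < q by rewrite ltr1n finNzRing_gt1.
have r0 : 0 <= Num.sqrt q by apply: sqrtr_ge0.
set r := Num.sqrt q in r0 *; set s := (5 * q + 2 * r + 5) / 8.
have sE : s - 1 = (5 * q + 2 * r - 3) / 8 by rewrite /s; field.
have s1 : 0 < s - 1 by rewrite sE; lra.
apply: (@le_lt_trans _ _ (q * \sum_(k < n) s ^+ k)).
  rewrite big_distrr /=; apply: ler_sum => k _.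
  apply: ler_wpM2l; first lra.
  by apply: lerXn2r; rewrite ?nnegrE /s; lra.
have -> : 8 * q / (5 * q + 2 * r - 3) * s ^+ n = q * (s ^+ n / (s - 1)).
  by rewrite sE invf_div; ring.
rewrite ltr_pM2l; last lra.
rewrite ltr_pdivlMr // mulrC -subrX1; lra.
Qed.
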